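(* Let $\mathcal{DB}_1$ be the set of functions $f:\mathbb{R}\to\mathbb{R}$ of Baire class one having the Darboux property, and let $\mathcal{AP}$ be the set of approximately continuous functions $f:\mathbb{R}\to\mathbb{R}$. Then the set $\mathcal{DB}_1\setminus\mathcal{AP}$ is strongly $\mathfrak{c}$-algebrable (as a subset of the algebra $\mathbb{R}^{\mathbb{R}}$).
   Context: A function $f:\mathbb{R}\to\mathbb{R}$ is of Baire class one if it is a pointwise limit of a sequence of continuous functions; it has the Darboux property if it maps every interval onto a connected set. The density topology on $\mathbb{R}$ consists of the empty set and all Lebesgue measurable sets $E$ such that $\lim_{h\to0^+}\frac{\lambda(E\cap[x-h,x+h])}{2h}=1$ for every $x\in E$, where $\lambda$ is Lebesgue measure. A function $f:\mathbb{R}\to\mathbb{R}$ is approximately continuous if it is continuous with respect to the density topology on the domain and the natural topology on the range. $\mathfrak{c}=2^{\omega}$ is the cardinality of the continuum. $\mathbb{R}^{\mathbb{R}}$ is the real commutative algebra of all functions $\mathbb{R}\to\mathbb{R}$ with pointwise operations. A subset $S$ of a commutative real algebra $\mathcal{L}$ is strongly $\kappa$-algebrable if $S\cup\{0\}$ contains a $\kappa$-generated algebra isomorphic to a free (commutative, non-unital) algebra; equivalently, there is a set $X\subseteq\mathcal{L}$ of cardinality $\kappa$ such that for every $k\ge 1$, every nonzero real polynomial $P$ in $k$ variables without constant term and all distinct $y_1,\dots,y_k\in X$, we have $P(y_1,\dots,y_k)\neq 0$ and $P(y_1,\dots,y_k)\in S$. *)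

(* Defs.v *)
From HB Require Import structures.
From mathcomp Require Import all_boot all_order all_algebra.
From mathcomp Require Import all_classical all_reals all_analysis.
(* The notations of mpoly clash with those of MathComp-Analysis. *)
From mathcomp Require Import -(notations) mpoly.

Set Implicit Arguments.
Unset Strict Implicit.
Unset Printing Implicit Defensive.

Import Order.TTheory GRing.Theory Num.Theory.
Import numFieldNormedType.Exports.

Local Open Scope classical_set_scope.
Local Open Scope card_scope.
Local Open Scope ring_scope.

Section functions_of_a_real_variable.
Context {R : realType}.
Implicit Types (f : R -> R) (E : set R).

Definition baire_class_one f : Prop :=
  exists g : nat -> R -> R,
    (forall n, continuous (g n)) /\ (forall x, g n x @[n --> \oo] --> f x).

Definition darboux f : Prop :=
  forall I : set R, is_interval I -> connected (f @` I).

(* The Caratheodory sigma-algebra of the outer measure generated by the length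
   of intervals is the domain of completed_lebesgue_measure; the library's
   default sigma-algebra on R is only the Borel one. *)
Definition lebesgue_measurable E : Prop :=
  ((wlength (@idfun R))^*%mu).-cara.-measurable E.

Definition density_at E (x : R) : Prop :=
  (completed_lebesgue_measure (E `&` `[(x - h)%R, (x + h)%R]) *
     ((2 * h)^-1)%:E)%E @[h --> 0^'+] --> 1%E.

Definition density_open E : Prop :=
  lebesgue_measurable E /\ forall x, E x -> density_at E x.

(* No topologicalType instance is built for the density topology: that these
   sets form a topology relies on the Lebesgue density theorem. *)
Definition approximately_continuous f : Prop :=
  forall U : set R, open U -> density_open (f @^-1` U).

End functions_of_a_real_variable.

Section algebrability.
Context {T : Type} {R : realType}.
Implicit Types (A X S : set (T -> R)).

Definition mpoly_fct n (P : mpoly n R) (y : 'I_n -> T -> R) : T -> R :=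
  fun t => meval (fun i => y i t) P.

Definition subalgebra A : Prop :=
  [/\ A 0,
      forall f g, A f -> A g -> A (f + g),
      forall f g, A f -> A g -> A (f * g) &
      forall (a : R) f, A f -> A (a *: f)].

Definition generated_algebra X : set (T -> R) := smallest subalgebra X.

(* The algebra generated by X is free on X as a commutative non-unital
   algebra, whose elements are the polynomials without constant term. *)
Definition free_generators X : Prop :=
  forall (k : nat) (P : mpoly k R) (y : 'I_k -> T -> R),
    (0 < k)%N -> P != 0 -> mcoeff mnm0 P = 0 ->
    injective y -> (forall i, X (y i)) ->
    mpoly_fct P y <> 0.

(* The cardinal kappa is represented by a set K of that cardinality. *)
Definition strongly_algebrable (U : Type) (K : set U) S : Prop :=
  exists X, [/\ X #= K, free_generators X &
                generated_algebra X `<=` S `|` [set 0]].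

End algebrability.

(* Main.v *)
Require Import Defs.
From mathcomp Require Import all_boot all_order all_algebra.
From mathcomp Require Import all_classical all_reals all_analysis.
From mathcomp Require Import ring lra.
From mathcomp Require Import -(notations) mpoly.

(** Cut ]0, 1[ into the dyadic intervals [2 ^- n.+1, 2 ^- n]. A real sequence
    [v] yields the function [tents v] whose graph over the n-th interval is a
    tent of height [v (ruler n)], where [ruler] takes each natural number
    infinitely often. So every shape that occurs once recurs at arbitrarily
    small scales, while the function vanishes at all the points 2 ^- n. These
    properties, collected in [recurrent], are preserved by pointwise sums,
    products and scalings: the algebra generated by any set of functions
    [tents v] consists of recurrent functions, and it never has to be described
    by polynomials.

    A recurrent function has Baire class one, being continuous on ]0, +oo[ and
    zero elsewhere, and its zeros 2 ^- n accumulating at 0 give it the Darboux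
    property. If it is not identically zero, then its absolute value exceeds
    some e > 0 on an interval ]a, b[ with 0 < a, hence on scaled copies
    ]s * a, s * b[ with s arbitrarily small; as these fill a fixed proportion of
    ]0, s * b[, the preimage of ]-e, e[, which contains 0, does not have density
    one at 0 ([recurrent_approximately_continuous_eq0]).

    It remains to find a free family of sequences indexed by the sets of natural
    numbers. As in the construction of large independent families, the index j
    runs through the finite tables that assign natural numbers to bit strings of
    some length m, and the sequence of A takes at j the value assigned to the
    first m bits of A. Finitely many distinct sets are told apart by their first
    m bits for some m, so their sequences take arbitrarily prescribed values at
    a common j ([table_value_interpolates]). Since a nonzero polynomial is
    nonzero at some point with natural coordinates ([mpoly_nonroot_nat]), no
    nonzero polynomial vanishes at distinct generators. *)

Set Implicit Arguments.
Unset Strict Implicit.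
Unset Printing Implicit Defensive.

Import Order.TTheory GRing.Theory Num.Theory.
Import numFieldNormedType.Exports.

Local Open Scope classical_set_scope.
Local Open Scope ring_scope.

(** * Natural points where a polynomial does not vanish *)

Lemma poly_nonroot_nat (R : numDomainType) (q : {poly R}) :
  q != 0 -> exists N : nat, q.[N%:R] != 0.
Proof.
move=> q0; apply: contrapT => q_vanishes.
suff : (size q < size q)%N by rewrite ltnn.
rewrite -[X in (X < _)%N](size_iota 0) -(size_map (fun i => i%:R : R)).
apply: max_poly_roots => //.
  apply/allP => _ /mapP[i _ ->]; apply: contrapT => /negP qi.
  by apply: q_vanishes; exists i.
rewrite map_inj_uniq ?iota_uniq// => i j /eqP.
by rewrite eqr_nat => /eqP.
Qed.

Lemma base_expansion_inj (D n : nat) (a b : 'I_n -> nat) :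
  (forall i, a i < D)%N -> (forall i, b i < D)%N ->
  (\sum_i a i * D ^ i = \sum_i b i * D ^ i)%N -> a =1 b.
Proof.
elim: n a b => [|n IHn] a b aD bD; first by move=> _ [].
have step (c : 'I_n.+1 -> nat) : (\sum_i c i * D ^ i =
    (\sum_i c (lift ord0 i) * D ^ i) * D + c ord0)%N.
  rewrite big_ord_recl expn0 muln1 addnC; congr addn.
  rewrite big_distrl; apply: eq_bigr => i _ /=.
  by rewrite /bump /= add1n expnSr mulnA.
rewrite !step => ab.
have ab0 : a ord0 = b ord0.
  by have := congr1 (modn^~ D) ab; rewrite !modnMDl !modn_small.
have D0 : (0 < D)%N by apply: leq_ltn_trans (aD ord0).
have {}ab : (\sum_i a (lift ord0 i) * D ^ i = \sum_i b (lift ord0 i) * D ^ i)%N.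
  by have := congr1 (divn^~ D) ab; rewrite !divnMDl// !divn_small// !addn0.
move=> i; case: (unliftP ord0 i) => [j|] ->//.
exact: (IHn (fun j => a (lift ord0 j)) (fun j => b (lift ord0 j))).
Qed.

(** Kronecker substitution: replacing the i-th variable by 'X^(D ^ i), with D
    larger than all the exponents that occur, sends distinct monomials to
    distinct powers of 'X by [base_expansion_inj]. This reduces the claim to one
    variable, where there are only finitely many roots. *)
Lemma mpoly_nonroot_nat (R : numDomainType) (k : nat) (P : mpoly k R) :
  P != 0 -> exists q : 'I_k -> nat, meval (fun i => (q i)%:R) P != 0.
Proof.
move=> P0; pose D := (msize P).+1.
pose e (m : multinom k) := (\sum_i m i * D ^ i)%N.
pose Q : {poly R} := \sum_(m <- msupp P) mcoeff m P *: 'X^(e m).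
have e_inj : {in msupp P &, injective e}.
  have small m i : m \in msupp P -> (m i < D)%N.
    move=> /msize_mdeg_lt mP; apply: leq_trans (leqW mP).
    by rewrite ltnS mdegE (bigD1 i)//= leq_addr.
  move=> m m' mP m'P /base_expansion_inj mm'; apply/mnmP => i.
  by apply: mm' => {}i; exact: small.
have [|N QN] := @poly_nonroot_nat _ Q.
  have mP := mlead_supp P0.
  apply/eqP => /(congr1 (fun q : {poly R} => q`_(e (mlead P)))).
  rewrite /Q coef0 coef_sum (bigD1_seq (mlead P))//= ?msupp_uniq//.
  rewrite coefZ coefXn eqxx mulr1 big_seq_cond big1 ?addr0.
    by apply/eqP; rewrite mleadc_eq0.
  move=> m /andP[mP' mm]; rewrite coefZ coefXn.
  case: eqP => [/e_inj|]; last by rewrite mulr0.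
  by move=> /(_ mP mP') mm'; rewrite mm' eqxx in mm.
exists (fun i => N ^ (D ^ i))%N; move: QN; congr (_ != 0).
rewrite mevalE /Q horner_sum; apply: eq_bigr => m _.
rewrite hornerZ hornerXn; congr (_ * _).
rewrite expr_sum; apply: eq_bigr => i _.
by rewrite natrX -exprM mulnC.
Qed.

(** * Finite tables indexed by bit strings *)

Definition first_bits (A : set nat) (m : nat) : seq bool :=
  mkseq (fun i => `[< A i >]) m.

Lemma first_bits_separate (k : nat) (A : 'I_k -> set nat) :
  injective A -> exists m, injective (fun i => first_bits (A i) m).
Proof.
move=> A_inj.
have sep (p : 'I_k * 'I_k) : exists d, p.1 != p.2 ->
    `[< A p.1 d >] != `[< A p.2 d >].
  apply: contrapT => /forallNP no_d.
  have [p12|p12] := eqVneq p.1 p.2.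
    by apply: (no_d 0%N); rewrite p12 eqxx.
  move/eqP : p12; apply; apply: A_inj; apply/funext => d; apply/propext.
  have /not_implyP[_ /negP] := no_d d; rewrite negbK => /eqP Ad.
  by split=> /asboolP Ai; apply/asboolP; rewrite ?Ad// -Ad.
have [d dP] := choice sep.
exists (\max_p (d p).+1) => i j ij; apply/eqP; apply: contraT => neq_ij.
have /negP[] := dP (i, j) neq_ij; apply/eqP.
have dm : (d (i, j) < \max_p (d p).+1)%N.
  by rewrite (bigD1 (i, j))//= leq_max leqnn.
by have := congr1 (fun s => nth false s (d (i, j))) ij; rewrite !nth_mkseq.
Qed.

(** The number j encodes a length [ml.1] and a finite table [ml.2] of pairs
    (bit string, value). *)
Definition table_value (A : set nat) (j : nat) : nat :=
  if unpickle j is Some ml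
  then \sum_(e <- (ml : nat * seq (seq bool * nat)).2 |
             e.1 == first_bits A ml.1) e.2
  else 0.

(** The table lists the pair of the first m bits of [A i] and [q i] for each i,
    where m is such that these bit strings are distinct. *)
Lemma table_value_interpolates (k : nat) (A : 'I_k -> set nat)
    (q : 'I_k -> nat) :
  injective A -> exists j, forall i, table_value (A i) j = q i.
Proof.
move=> /first_bits_separate[m pm_inj].
exists (pickle (m, [seq (first_bits (A i) m, q i) | i <- enum 'I_k])) => i.
rewrite /table_value pickleK big_map big_enum_cond/= (big_pred1 i)// => i'.
by rewrite /= (inj_eq pm_inj).
Qed.

(** * Recurrent functions *)

(** The 2-adic valuation of n + 1 is one explicit sequence that takes each
    value infinitely often. *)
Definition ruler (n : nat) : nat := logn 2 n.+1.

Lemma ruler_recurs (j N : nat) : exists2 n, (N <= n)%N & ruler n = j.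
Proof.
(* 2 ^ j times the odd number 2 N + 1 has valuation j. *)
exists (2 ^ j * N.*2.+1).-1.
  rewrite -ltnS prednK ?muln_gt0 ?expn_gt0//.
  rewrite (leq_trans _ (leq_pmull _ _)) ?expn_gt0// ltnS -addnn leq_addr//.
rewrite /ruler prednK ?muln_gt0 ?expn_gt0// lognM ?expn_gt0// pfactorK//.
by rewrite lognE /= dvdn2 /= odd_double addn0.
Qed.

Section recurrent_functions.
Context {R : realType}.
Implicit Types (F G : R -> R) (n : nat).

(** The last clause says that the rescaled shape of [F] on the n-th dyadic
    interval is determined by [ruler n]. The scales that share a shape are
    the same for all functions, so a sum or a product of recurrent functions
    inherits the repetitions of its terms. *)
Definition recurrent F : Prop :=
  [/\ forall x, ~~ (0 < x < 1) -> F x = 0,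
      forall n, F (2 ^- n) = 0,
      forall x, 0 < x -> {for x, continuous F} &
      forall n n' u, ruler n = ruler n' -> 2^-1 <= u <= 1 ->
        F (2 ^- n * u) = F (2 ^- n' * u)].

Lemma subalgebra_recurrent : subalgebra [set F | recurrent F].
Proof.
split=> [|F G [F0 Fz Fc Fs] [G0 Gz Gc Gs]|F G [F0 Fz Fc Fs] [G0 Gz Gc Gs]|
  a F [F0 Fz Fc Fs]] /=.
- by split=> // x _; exact: cst_continuous.
- split=> [x x01|n|x x0|n n' u nn' u1]; rewrite /= ?fctE.
  + by rewrite F0// G0// addr0.
  + by rewrite Fz Gz addr0.
  + by apply: continuousD; [exact: Fc|exact: Gc].
  + by rewrite (Fs n n')// (Gs n n').
- split=> [x x01|n|x x0|n n' u nn' u1]; rewrite /= ?fctE.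
  + by rewrite F0// mul0r.
  + by rewrite Fz mul0r.
  + by apply: continuousM; [exact: Fc|exact: Gc].
  + by rewrite (Fs n n')// (Gs n n').
- split=> [x x01|n|x x0|n n' u nn' u1]; rewrite /= ?fctE.
  + by rewrite F0// scaler0.
  + by rewrite Fz scaler0.
  + by apply: continuousZr; exact: Fc.
  + by rewrite (Fs n n').
Qed.

Lemma dyadic_lt (x : R) : 0 < x -> exists n, 2 ^- n < x.
Proof.
move=> x0; exists (Num.truncn x^-1).+1.
rewrite invf_plt ?posrE ?exprn_gt0//.
rewrite (lt_trans (truncnS_gt _))//.
by rewrite -natrX ltr_nat ltn_expl.
Qed.

Lemma dyadic_interval (x : R) : 0 < x < 1 ->
  exists n, 2 ^- n.+1 <= x < 2 ^- n.
Proof.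
move=> /andP[x0 x1].
have ex : exists n, 2 ^- n.+1 <= x.
  have [n nx] := dyadic_lt x0; exists n; apply: le_trans (ltW nx).
  by rewrite lef_pV2 ?posrE ?exprn_gt0// ler_eXn2l ?ltr1n.
exists (ex_minn ex); case: ex_minnP => n nx n_min; rewrite nx/=.
case: n => [|n] in nx n_min *; first by rewrite expr0 invr1.
rewrite ltNge; apply/negP => /n_min.
by rewrite ltnn.
Qed.

(** The continuous approximations freeze [F] to the left of 2 ^- n at its value
    there, which is 0, the value of [F] on ]-oo, 0]. *)
Lemma recurrent_baire_class_one F : recurrent F -> baire_class_one F.
Proof.
move=> [F0 Fz Fc _].
exists (fun n x => F (Num.max x (2 ^- n))); split.
  move=> n x; apply: (@continuous_comp R R R (fun x => Num.max x (2 ^- n)) F x).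
    apply: (@continuous_max R R (fun x : R => x) (cst (2 ^- n))) => //.
    exact: cst_continuous.
  by apply: Fc; rewrite lt_max invr_gt0 exprn_gt0 ?orbT.
move=> x; have [x0|x0] := ltP 0 x; last first.
  rewrite F0; last by rewrite negb_and -leNgt x0.
  rewrite (_ : (fun n => _) = (fun=> 0)); first exact: cvg_cst.
  apply/funext => n; rewrite max_r ?Fz// (le_trans x0)// invr_ge0 exprn_ge0//.
have [N Nx] := dyadic_lt x0.
apply: cvg_near_cst; near=> n.
rewrite max_l//; apply: le_trans (ltW Nx).
rewrite lef_pV2 ?posrE ?exprn_gt0// ler_eXn2l ?ltr1n//.
by near: n; exact: nbhs_infty_ge.
Unshelve. all: by end_near. Qed.

(** An interval that meets both sides of the origin contains some 2 ^- n, so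
    passing to its positive part, on which [F] is continuous, does not lose the
    value 0. *)
Lemma recurrent_darboux F : recurrent F -> darboux F.
Proof.
move=> [F0 Fz Fc _] I I_itv.
pose J := I `&` `]0, +oo[%classic.
have FJ : connected (F @` J).
  apply: connected_continuous_connected; last first.
    apply: continuous_in_subspaceT => x; rewrite inE => -[_] /=.
    by rewrite in_itv/= andbT => /Fc.
  apply/connected_intervalP => x y [Ix]; rewrite /= !in_itv/= !andbT => x0.
  move=> [Iy y0] z /andP[xz zy]; split.
    by apply: (I_itv x y) => //; rewrite xz.
  by rewrite /= in_itv/= (lt_le_trans x0).
have [I_pos|] := pselect (I `<=` `]0, +oo[%classic).
  by move: FJ; rewrite /J setIidl.
move=> /existsNP[a /not_implyP[Ia]]; rewrite /= in_itv/= andbT => /negP.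
rewrite -leNgt => a0.
have Fneg x : x <= 0 -> F x = 0 by move=> x0; rewrite F0// negb_and -leNgt x0.
have [[b [Ib]]|J0] := pselect (J !=set0).
  rewrite /= in_itv/= andbT => b0.
  suff -> : F @` I = F @` J by [].
  apply/seteqP; split=> _ [x Ix <-]; last by exists x => //; exact: (proj1 Ix).
  have [x0|x0] := ltP 0 x.
    by exists x => //; split=> //=; rewrite in_itv/= x0.
  have [n nb] := dyadic_lt b0; exists (2 ^- n); last by rewrite Fz Fneg.
  have n0 : (0 : R) < 2 ^- n by rewrite invr_gt0 exprn_gt0.
  split; last by rewrite /= in_itv/= n0.
  by apply: (I_itv a b) => //; rewrite (ltW nb) (le_trans a0)// ltW.
suff -> : F @` I = [set 0] by exact: connected1.
apply/seteqP; split=> [_ [x Ix <-]|_ ->] /=; last first.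
  by exists a => //; exact: Fneg.
apply: Fneg; rewrite leNgt; apply/negP => x0.
by apply: J0; exists x; split=> //=; rewrite in_itv/= x0.
Qed.

(** At the scales h = s * b the set [E] leaves out the part [s * a, s * b] of
    [- h, h], so it occupies at most the proportion (a + b) / (2 * b) < 1. *)
Lemma not_density_point (E : set R) (a b : R) : 0 < a < b ->
  (forall h : R, 0 < h -> exists s : R, [/\ 0 < s, s * b < h &
     forall x, s * a <= x <= s * b -> ~ E x]) ->
  ~ density_at E 0.
Proof.
move=> /andP[a0 ab] E_gap E_density.
have b0 : 0 < b by exact: lt_trans ab.
(* If 0 were a density point, [E] would occupy more than the proportion c at
   all small scales. *)
pose c := (a + b) / (2 * b).
have c1 : (c%:E < 1%:E)%E.
  by rewrite lte_fin /c ltr_pdivrMr ?mul1r ?mulr_gt0//; lra.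
have : nbhs 1%E [set y : \bar R | (c%:E < y)%E].
  by apply: open_nbhs_nbhs; split => //; exact: open_ereal_gt_ereal.
move=> /E_density [d /= d0 dE].
have [s [s0 sbd sE]] := E_gap d d0.
have := dE (s * b); rewrite /ball_ /= sub0r normrN gtr0_norm ?mulr_gt0//.
move=> /(_ sbd isT); apply/negP; rewrite -leNgt.
have sub : E `&` `[0 - s * b, 0 + s * b] `<=` `[- (s * b), s * a].
  move=> x [Ex]; rewrite /= !in_itv/= sub0r add0r => /andP[-> xb] /=.
  by rewrite leNgt; apply/negP => xa; apply: (sE x) => //; rewrite xb ltW.
have mu_le : (completed_lebesgue_measure
    (E `&` `[(0 - s * b)%R, (0 + s * b)%R]) <=
    (s * (a + b))%R%:E)%E.
  have <- : lebesgue_measure `[- (s * b), s * a]%classic = (s * (a + b))%:E.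
    rewrite lebesgue_measure_itv/= lte_fin ifT; last first.
      by rewrite (@lt_trans _ _ 0) ?oppr_lt0 ?mulr_gt0.
    by rewrite -EFinB opprK -mulrDr.
  exact: (le_outer_measure ((wlength idfun)^*)%mu _ _ sub).
apply: (@le_trans _ _ ((s * (a + b))%R%:E * ((2 * (s * b))^-1)%R%:E)%E).
  apply: lee_wpmul2r; last by move: mu_le; rewrite sub0r.
  by rewrite lee_fin invr_ge0 mulr_ge0// mulr_ge0// ltW.
rewrite -EFinM lee_fin /c.
by rewrite le_eqVlt; apply/orP; left; apply/eqP; field; rewrite !gt_eqF.
Qed.

Lemma recurrent_approximately_continuous_eq0 F :
  recurrent F -> approximately_continuous F -> F = 0.
Proof.
move=> [F0 Fz Fc Fs] Fap; apply/funext => x; rewrite [RHS]/=.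
apply: contrapT => /eqP Fx.
have x01 : 0 < x < 1 by apply: contra_neqT Fx => /F0.
have [n /andP[nx xn]] := dyadic_interval x01.
have /andP[x0 _] := x01.
have n0 : (0 : R) < 2 ^- n by rewrite invr_gt0 exprn_gt0.
pose e := `|F x| / 2.
have e0 : 0 < e by rewrite divr_gt0 ?normr_gt0.
have : \forall y \near x, e < `|F y|.
  have : {for x, continuous (fun y => `|F y|)}.
    by apply: continuous_comp; [exact: Fc|exact: norm_continuous].
  move=> /(_ [set y : R | e < y]); apply.
  apply: open_nbhs_nbhs; split; first exact: open_gt.
  by rewrite /= /e ltr_pdivrMr// mulr2n mulrDr mulr1 ltrDl normr_gt0.
move=> [d /= d0 dF].
(* Staying within the n-th dyadic interval makes the whole of [x, b] recur. *)
pose b := Num.min (x + d / 2) (2 ^- n).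
have xb : x < b by rewrite lt_min xn ltrDl divr_gt0.
have Fb y : x <= y <= b -> e < `|F y|.
  move=> /andP[xy]; rewrite le_min => /andP[yd _]; apply: dF.
  rewrite /= distrC ger0_norm ?subr_ge0//; lra.
pose E := F @^-1` [set y | `|y| < e].
have E0 : E 0 by rewrite /E/= F0 ?ltxx// normr0.
have [|_ /(_ 0 E0)] := Fap [set y | `|y| < e].
  rewrite (_ : mkset _ = ball_ Num.norm 0 e); last first.
    by apply/funext => y; rewrite /ball_/= sub0r normrN.
  exact: ball_open.
apply: (@not_density_point _ (2 ^+ n * x) (2 ^+ n * b)).
  by rewrite mulr_gt0 ?exprn_gt0//= ltr_pM2l ?exprn_gt0.
move=> h h0.
have [N Nh] := dyadic_lt h0.
have [n' Nn' nn'] := ruler_recurs (ruler n) N.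
have n'0 : (0 : R) < 2 ^- n' by rewrite invr_gt0 exprn_gt0.
exists (2 ^- n'); split=> //.
  apply: le_lt_trans Nh.
  have /(ler_wpM2l (exprn_ge0 n (ler0n R 2))) : b <= 2 ^- n.
    by rewrite ge_min lexx orbT.
  rewrite divff ?expf_neq0// => {}b1.
  rewrite (@le_trans _ _ (2 ^- n' * 1))//.
    by rewrite ler_wpM2l// invr_ge0 exprn_ge0.
  by rewrite mulr1 lef_pV2 ?posrE ?exprn_gt0// ler_eXn2l ?ltr1n.
move=> y /andP[xy yb].
have P0 m : (0 : R) < 2 ^+ m by rewrite exprn_gt0.
(* Rescaling y from the n'-th to the n-th dyadic interval yields a point of
   [x, b]. *)
pose u := 2 ^+ n' * y.
have yu : y = 2 ^- n' * u by rewrite /u mulKf// gt_eqF.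
have xu : x <= 2 ^- n * u.
  by rewrite ler_pdivlMl// -(ler_pM2l n'0)// -yu.
have ub : 2 ^- n * u <= b.
  by rewrite ler_pdivrMl// -(ler_pM2l n'0)// -yu.
have u1 : 2^-1 <= u <= 1.
  apply/andP; split.
    have := le_trans nx xu; rewrite -(ler_pM2l (P0 n)) mulVKf ?gt_eqF//.
    by rewrite exprS invfM mulrCA divff ?gt_eqF// mulr1.
  have : 2 ^- n * u <= 2 ^- n by rewrite (le_trans ub)// ge_min lexx orbT.
  by rewrite -{2}[2 ^- n]mulr1 ler_pM2l.
rewrite /E/= yu (Fs n' n)//; apply/negP; rewrite -leNgt ltW// Fb//.
by rewrite xu ub.
Qed.

End recurrent_functions.

(** * Sums of dyadic tents *)

Section dyadic_tents.
Context {R : realType}.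
Implicit Types (v : nat -> R) (n : nat).

Definition tent (t : R) : R := Num.max (1 - `|4 * t - 3|) 0.

Lemma tent_eq0 t : ~~ (2^-1 < t < 1) -> tent t = 0.
Proof.
move=> t_out; rewrite /tent max_r// subr_le0; move: t_out.
rewrite negb_and -!leNgt => /orP[t2|t1].
  by rewrite ler0_norm; lra.
by rewrite ger0_norm; lra.
Qed.

Lemma tent_peak : tent (3 / 4) = 1.
Proof.
rewrite /tent (_ : 4 * (3 / 4) - 3 = 0 :> R) ?normr0 ?subr0 ?max_l//.
by field.
Qed.

Lemma continuous_tent : continuous tent.
Proof.
move=> t; apply: (@continuous_max R R (fun t => 1 - `|4 * t - 3|) (cst 0)).
  apply: continuousB; first exact: cst_continuous.
  apply: continuous_comp; last exact: norm_continuous.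
  apply: continuousB; last exact: cst_continuous.
  exact: mulrl_continuous.
exact: cst_continuous.
Qed.

(** This is the sum over all n: the support of the n-th tent is
    [2 ^- n.+1, 2 ^- n], so only terms with n < x^-1 contribute if 0 < x, and
    none does if x <= 0. *)
Definition tents v (x : R) : R :=
  \sum_(n < (Num.truncn x^-1).+1) v (ruler n) * tent (2 ^+ n * x).

(** The number of terms depends on the point in the definition of [tents]; near
    a positive point it can be chosen constant, which is how continuity is
    obtained. *)
Lemma tents_truncated v N x : x^-1 <= N%:R ->
  tents v x = \sum_(n < N) v (ruler n) * tent (2 ^+ n * x).
Proof.
have tail0 n : x^-1 <= n%:R -> tent (2 ^+ n * x) = 0.
  move=> xn; apply: tent_eq0; rewrite negb_and -!leNgt.
  have [x0|x0] := ltP 0 x; apply/orP; [right|left].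
    rewrite -ler_pdivrMr// div1r (le_trans xn)//.
    by rewrite -natrX ler_nat ltnW// ltn_expl.
  by rewrite (@le_trans _ _ 0)// mulr_ge0_le0// exprn_ge0.
have extend M K : x^-1 <= M%:R -> \sum_(n < M) v (ruler n) * tent (2 ^+ n * x) =
    \sum_(n < M + K) v (ruler n) * tent (2 ^+ n * x).
  move=> xM; rewrite big_split_ord/= [X in _ + X]big1 ?addr0// => n _.
  by rewrite tail0 ?mulr0// (le_trans xM)// ler_nat leq_addr.
move=> xN; rewrite (extend N (Num.truncn x^-1).+1 xN) addnC -extend//.
exact: ltW (truncnS_gt _).
Qed.

Lemma tents_dyadic v n u : 2^-1 <= u <= 1 ->
  tents v (2 ^- n * u) = v (ruler n) * tent u.
Proof.
move=> /andP[u2 u1].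
have u0 : 0 < u by apply: lt_le_trans u2.
pose N := (Num.truncn (2 ^- n * u)^-1 + n).+1.
rewrite (@tents_truncated _ N); last first.
  apply: ltW; apply: lt_le_trans (truncnS_gt _) _.
  by rewrite ler_nat ltnS leq_addr.
have nN : (n < N)%N by rewrite ltnS leq_addl.
rewrite (bigD1 (Ordinal nN))//= big1 ?addr0; last first.
  move=> i; rewrite -val_eqE/= => ni.
  rewrite tent_eq0 ?mulr0// negb_and -!leNgt mulrA.
  have [ltin|lein] := ltnP i n; apply/orP; [left|right].
    rewrite (@le_trans _ _ (2 ^+ i / 2 ^+ n))//.
      by rewrite ler_piMr// divr_ge0// exprn_ge0.
    rewrite ler_pdivrMr ?exprn_gt0// ler_pdivlMl// -exprS.
    by rewrite ler_eXn2l ?ltr1n.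
  have ni' : 2 <= 2 ^+ i / 2 ^+ n :> R.
    rewrite ler_pdivlMr ?exprn_gt0// -exprS ler_eXn2l ?ltr1n//.
    by rewrite ltn_neqAle eq_sym ni.
  rewrite -[leLHS](@divff _ 2) ?pnatr_eq0//.
  by apply: ler_pM.
by rewrite mulVKf// gt_eqF// exprn_gt0.
Qed.

Lemma recurrent_tents v : recurrent (tents v).
Proof.
split.
- move=> x x01; rewrite /tents big1// => n _.
  rewrite tent_eq0 ?mulr0//; apply: contraNN x01 => /andP[nx xn].
  have nx0 : 0 < 2 ^+ n * x by apply: lt_trans nx.
  have x0 : 0 < x by move: nx0; rewrite pmulr_rgt0// exprn_gt0.
  by rewrite x0 (le_lt_trans _ xn)// ler_peMl ?(ltW x0)// exprn_ege1// ler1n.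
- move=> n; rewrite -[2 ^- n]mulr1 tents_dyadic.
    by rewrite tent_eq0 ?mulr0// ltxx andbF.
  by rewrite lexx invf_le1 ?ler1n.
- move=> x x0; pose N := (Num.truncn (x / 2)^-1).+1.
  have near_sum : \forall y \near x,
      tents v y = \sum_(n < N) v (ruler n) * tent (2 ^+ n * y).
    have : \forall y \near x, x / 2 < y.
      apply: lt_nbhsr; rewrite ltr_pdivrMr// mulr2n mulrDr mulr1 ltrDl//.
    apply: filterS => y xy; apply: tents_truncated.
    rewrite (le_trans _ (ltW (truncnS_gt _)))//.
    rewrite lef_pV2 ?posrE ?divr_gt0// ?ltW//.
    by rewrite (lt_trans _ xy)// divr_gt0.
  have sum_cont : continuous (fun y : R =>
      \sum_(n < N) v (ruler n) * tent (2 ^+ n * y)).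
    rewrite [X in continuous X](_ : _ =
      \sum_(n < N) (fun y => v (ruler n) * tent (2 ^+ n * y))) ?fct_sumE//.
    rewrite -fct_sumE.
    elim/big_ind : _ => [|f g cf cg y|n _ y]; first exact: cst_continuous.
      by apply: continuousD; [exact: cf|exact: cg].
    apply: (@continuousM R R (cst _) (fun z => tent (2 ^+ n * z))).
      exact: cst_continuous.
    apply: continuous_comp; last exact: continuous_tent.
    exact: mulrl_continuous.
  rewrite /prop_for /continuous_at (nbhs_singleton near_sum).
  apply: cvg_trans (sum_cont x); apply: near_eq_cvg.
  by apply: filterS near_sum => y ->.
- by move=> n n' u nn' u1; rewrite !tents_dyadic// nn'.
Qed.

End dyadic_tents.

(** * The free generators *)

Section generators.
Context {R : realType}.

Definition generator (A : set nat) : R -> R :=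
  tents (fun j => (table_value A j)%:R).

(** Interpolation happens at the peak, located at 3 / 4 of the dyadic interval,
    of a tent with the right shape number. *)
Lemma generator_interpolates (k : nat) (A : 'I_k -> set nat) (q : 'I_k -> nat) :
  injective A -> exists x, forall i, generator (A i) x = (q i)%:R.
Proof.
move=> /(table_value_interpolates q)[j jq].
have [n _ nj] := ruler_recurs j 0.
exists (2 ^- n * (3 / 4)) => i.
rewrite /generator tents_dyadic ?nj ?jq ?tent_peak ?mulr1//.
by apply/andP; split; lra.
Qed.

Lemma generator_inj : injective generator.
Proof.
move=> A B AB; apply: contrapT => neqAB.
(* Distinct sets give generators taking the values 0 and 1 at a common point. *)
pose AB_ (i : 'I_2) := if i == ord0 then A else B.
have [|x xq] := @generator_interpolates 2 AB_ val.
  move=> i j; rewrite /AB_.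
  case: (eqVneq i ord0) (eqVneq j ord0) => [->|i0] [->|j0] //.
  - by move=> /esym.
  - by move: i j i0 j0 => [[|[|//]] ?] [[|[|//]] ?] // _ _ _; exact: val_inj.
have := xq ord0; rewrite /AB_ eqxx AB; have /= -> := xq (lift ord0 ord0).
by move=> /eqP; rewrite eqr_nat.
Qed.

Lemma free_generator : free_generators (range generator).
Proof.
move=> k P y _ P0 _ y_inj y_gen.
have /choice[A Ay] : forall i, exists A, generator A = y i.
  by move=> i; have [A _ Ay] := y_gen i; exists A.
have A_inj : injective A by move=> i j ij; apply: y_inj; rewrite -!Ay ij.
have [q qP] := mpoly_nonroot_nat P0.
have [x xq] := generator_interpolates q A_inj.
move=> /(congr1 (fun f => f x)); apply/eqP; rewrite [X in _ != X]/=.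
rewrite /mpoly_fct (_ : (fun i => y i x) = (fun i => (q i)%:R))//.
by apply/funext => i; rewrite -Ay.
Qed.

End generators.

Theorem theorem5p3 (R : realType) :
  strongly_algebrable [set: set nat]
    ([set f : R -> R | baire_class_one f /\ darboux f] `\`
     [set f : R -> R | approximately_continuous f]).
Proof.
exists (range generator); split; first 2 last.
- move=> F /(_ [set G | recurrent G])[].
    split; first exact: subalgebra_recurrent.
    by move=> _ [A _ <-]; exact: recurrent_tents.
- move=> F0 Fz Fc Fs; have F_rec : recurrent F by split.
  have [->|F_neq0] := pselect (F = 0); [by right|left].
  split=> [|/(recurrent_approximately_continuous_eq0 F_rec)//].
  split; [exact: recurrent_baire_class_one|exact: recurrent_darboux].
- apply: inj_card_eq; apply: in2W; exact: generator_inj.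
- exact: free_generator.
Qed.
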